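(* The stationary probability distribution $\pi^{\mathrm i}$ of the stoned inhomogeneous TASEP $\blacktriangle\mathrm{iTASEP}_\lambda$ is given by \[\pi^{\mathrm i}(\mu,\sigma)=\frac1{|\Omega|}\lim_{R\to\infty}\frac{\Psi_\mu(\sigma\boldsymbol\chi)}{\Pi_\lambda(\boldsymbol\chi)}\qquad((\mu,\sigma)\in S_\lambda\times\Omega).\]
   Context: Fix parameters $a_k\in(0,1)$ for each integer $k\ge0$, and a nondecreasing tuple $\lambda=(\lambda_1\le\cdots\le\lambda_n)$ of nonnegative integers with set of rearrangements $S_\lambda$. For $w\in\mathfrak S_n$ and a tuple $y$, $wy=(y_{w^{-1}(1)},\dots,y_{w^{-1}(n)})$; for a polynomial $f$, $(wf)(\mathbf x)=f(w\mathbf x)$. Indices are modulo $n$; $\overline s_i$ ($i\in\mathbb Z/n\mathbb Z$) is the transposition of $i$ and $i+1$; $c$ is the cycle $(1\,2\cdots n)$. Inhomogeneous TASEP polynomials (Cantini) $(\Psi_\mu(\mathbf x))_{\mu\in S_\lambda}$ are polynomials in $x_1,\dots,x_n$ with coefficients rational in $a_{\lambda_1},\dots,a_{\lambda_n}$, determined up to a common scalar factor (a normalization is fixed) by: $\frac{x_i(x_{i+1}-a_{\mu_{i+1}})}{a_{\mu_{i+1}}(x_i-x_{i+1})}(1-\overline s_i)\Psi_\mu=\Psi_{\overline s_i\mu}$ if $\mu_i<\mu_{i+1}$; $\overline s_i\Psi_\mu=\Psi_\mu$ if $\mu_i=\mu_{i+1}$; $c\Psi_{c\mu}=\Psi_\mu$.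 $\Pi_\lambda=\sum_{\mu\in S_\lambda}\Psi_\mu$ (a symmetric polynomial). Stones $\blacktriangle_1,\dots,\blacktriangle_n$ with densities $\varrho$ taking exactly the two values $1,2$, $1=\varrho(\blacktriangle_1)\le\cdots\le\varrho(\blacktriangle_n)=2$. $\Omega$: the $\sigma\in\mathfrak S_n$ such that for each density the stones of that density appear in the same cyclic order in $\blacktriangle_{\sigma^{-1}(1)},\dots,\blacktriangle_{\sigma^{-1}(n)}$ as in $\blacktriangle_1,\dots,\blacktriangle_n$ (stone $\blacktriangle_j$ sits on site $\sigma(j)$ of a ring $\mathbb Z/n\mathbb Z$). $\mathfrak K(\sigma)=\#\{i:\varrho(\blacktriangle_{\sigma^{-1}(i)})<\varrho(\blacktriangle_{\sigma^{-1}(i+1)})\}$. For each $j$ with $\varrho(\blacktriangle_j)=1$ fix $p(j)\in[0,1)$, with $p(j)>0$ for at least one such $j$. For real $R>1$ let $\boldsymbol\chi=(\chi_1,\dots,\chi_n)$ with $\chi_j=1/p(j)$ if $\varrho(\blacktriangle_j)=1$ and $p(j)>0$, and $\chi_j=R$ otherwise. $\blacktriangle\mathrm{iTASEP}_\lambda$ is the Markov chain on $S_\lambda\times\Omega$: if $\varrho(\blacktriangle_{\sigma^{-1}(i)})<\varrho(\blacktriangle_{\sigma^{-1}(i+1)})$ and $\mu_i>\mu_{i+1}$, then $\mathbb P((\mu,\sigma)\to(\overline s_i\mu,\overline s_i\sigma))=\frac1np(\sigma^{-1}(i))a_{\mu_i}$ and $\mathbb P((\mu,\sigma)\to(\mu,\overline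 s_i\sigma))=\frac1n[1-p(\sigma^{-1}(i))a_{\mu_i}]$; if the density condition holds and $\mu_i\le\mu_{i+1}$, $\mathbb P((\mu,\sigma)\to(\mu,\overline s_i\sigma))=\frac1n$; $\mathbb P((\mu,\sigma)\to(\mu,\sigma))=1-\mathfrak K(\sigma)/n$; all other probabilities $0$. This chain is irreducible. (Its stone marginal, the auxiliary TASEP, is uniform on $\Omega$.) *)

(* Defs.v *)
From HB Require Import structures.
From mathcomp Require Import all_boot all_order all_algebra all_fingroup.
From mathcomp Require Import all_classical all_reals all_analysis.
From mathcomp Require mpoly.
Set Implicit Arguments. Unset Strict Implicit. Unset Printing Implicit Defensive.
Import Order.TTheory GRing.Theory Num.Theory.
Local Open Scope ring_scope.

(* Sites 1..n and stones 1..n are both encoded by 'I_n (0-based).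
   Indices are taken modulo n: the successor of site i is ordS i. *)

Section Stoned.
Variable n : nat.

Definition act_tuple (T : Type) (w : 'S_n) (y : 'I_n -> T) : 'I_n -> T :=
  fun j => y (w^-1%g j).

Definition act_word (w : 'S_n) (mu : seq nat) : seq nat :=
  [seq nth 0%N mu (w^-1%g j) | j <- enum 'I_n].

Definition sbar (i : 'I_n) : 'S_n := tperm i (ordS i).

Definition cyc : 'S_n := perm (@ordS_inj n).

Variable R : realType.

Notation poly := (mpoly.mpoly n R).
Definition ev (x : 'I_n -> R) (f : poly) : R := mpoly.meval x f.

(* The defining relations of the inhomogeneous TASEP polynomials
   (Psi_mu)_{mu in S_lambda}, written as polynomial identities (i.e. for
   every real point x); the exchange relation is multiplied through by
   a_{mu_{i+1}} (x_i - x_{i+1}). *)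
Definition is_iTASEP_family (a : nat -> R) (lam : seq nat)
    (Psi : seq nat -> poly) : Prop :=
  forall mu, mu \in permutations lam ->
  [/\ forall (i : 'I_n) (x : 'I_n -> R),
        (nth 0%N mu i < nth 0%N mu (ordS i))%N ->
        x i * (x (ordS i) - a (nth 0%N mu (ordS i)))
          * (ev x (Psi mu) - ev (act_tuple (sbar i) x) (Psi mu))
        = a (nth 0%N mu (ordS i)) * (x i - x (ordS i))
          * ev x (Psi (act_word (sbar i) mu)),
      forall (i : 'I_n) (x : 'I_n -> R),
        nth 0%N mu i = nth 0%N mu (ordS i) ->
        ev (act_tuple (sbar i) x) (Psi mu) = ev x (Psi mu)
    & forall x : 'I_n -> R,
        ev (act_tuple cyc x) (Psi (act_word cyc mu)) = ev x (Psi mu)].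

Definition Pi_ev (lam : seq nat) (Psi : seq nat -> poly) (x : 'I_n -> R) : R :=
  \sum_(mu <- permutations lam) ev x (Psi mu).

Variable rho : 'I_n -> nat.   (* densities of the stones *)

Definition cyc_eq (s t : seq nat) : bool :=
  has (fun k => s == rot k t) (iota 0 (size t).+1).

(* stones of density d, listed along the sites 1..n for configuration sigma *)
Definition stones_along (d : nat) (sigma : 'S_n) : seq nat :=
  [seq nat_of_ord (sigma^-1%g i) | i <- enum 'I_n & rho (sigma^-1%g i) == d].
Definition stones_of (d : nat) : seq nat :=
  [seq nat_of_ord j | j <- enum 'I_n & rho j == d].

(* Omega (densities take only the values 1 and 2) *)
Definition Omega : {set 'S_n} :=
  [set sigma | cyc_eq (stones_along 1 sigma) (stones_of 1)
            && cyc_eq (stones_along 2 sigma) (stones_of 2)].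

Definition up (sigma : 'S_n) (i : 'I_n) : bool :=
  (rho (sigma^-1%g i) < rho (sigma^-1%g (ordS i)))%N.

Definition Kfrak (sigma : 'S_n) : nat := #|[set i | up sigma i]|.

Variables (a : nat -> R) (p : 'I_n -> R).

(* Transition probability of the stoned inhomogeneous TASEP.
   \bar s_i sigma is the composite \bar s_i o sigma, i.e. (sigma * sbar i)%g. *)
Definition trans (mu : seq nat) (sigma : 'S_n) (mu' : seq nat) (sigma' : 'S_n) : R :=
  (if (mu' == mu) && (sigma' == sigma) then 1 - (Kfrak sigma)%:R / n%:R else 0)
  + \sum_(i : 'I_n | up sigma i)
      (if (nth 0%N mu (ordS i) < nth 0%N mu i)%N then
         (if (mu' == act_word (sbar i) mu) && (sigma' == (sigma * sbar i)%g)
          then n%:R^-1 * (p (sigma^-1%g i) * a (nth 0%N mu i)) else 0)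
         + (if (mu' == mu) && (sigma' == (sigma * sbar i)%g)
          then n%:R^-1 * (1 - p (sigma^-1%g i) * a (nth 0%N mu i)) else 0)
       else
         (if (mu' == mu) && (sigma' == (sigma * sbar i)%g) then n%:R^-1 else 0)).

Definition is_stationary_distribution (lam : seq nat)
    (pi : seq nat -> 'S_n -> R) : Prop :=
  [/\ forall mu sigma, mu \in permutations lam -> sigma \in Omega ->
        0 <= pi mu sigma,
      \sum_(mu <- permutations lam) \sum_(sigma in Omega) pi mu sigma = 1
    & forall mu' sigma', mu' \in permutations lam -> sigma' \in Omega ->
        pi mu' sigma' =
        \sum_(mu <- permutations lam) \sum_(sigma in Omega)
           pi mu sigma * trans mu sigma mu' sigma'].

(* the vector chi depending on the real parameter r (= R in the paper) *)
Definition chi (r : R) : 'I_n -> R :=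
  fun j => if (rho j == 1%N) && (0 < p j) then (p j)^-1 else r.

End Stoned.

(* Main.v *)
Require Import Defs.
From HB Require Import structures.
From mathcomp Require Import all_boot all_order all_algebra all_fingroup.
From mathcomp Require Import all_classical all_reals all_analysis.
From mathcomp Require mpoly.
From mathcomp Require Import ring lra zify.
Set Implicit Arguments. Unset Strict Implicit. Unset Printing Implicit Defensive.
Import Order.TTheory GRing.Theory Num.Theory numFieldNormedType.Exports.
Local Open Scope classical_set_scope.
Local Open Scope ring_scope.

(* Write [F_mu(x)] for [Psi_mu] at [x]. If all [x_j >= 1], the defining relations
   say that [F(s_i x)] is the image of [F(x)] under the operator that sorts a
   descent of [mu] at sites i, i+1 with larger particle k with probability
   [a_k (x_{i+1} - x_i) / (x_i (x_{i+1} - a_k))]. Sorting preserves total mass, so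
   [Pi] is symmetric; when a stone moves in the auxiliary TASEP, [x_i = 1/p] and
   [x_{i+1} = R], and the probability tends to [p a_k], the one of the stoned
   chain. Stationarity of the limit follows because the two densities make the
   ring have as many ascents as descents.

   The limit exists and is nonnegative because the [F_mu(x)] all have the same
   sign when [x] is not constant. Indeed, a function of [w] in [S_n] which does not
   increase along the moves [w -> s_i w] with [(wx)_i <= (wx)_{i+1}] is constant:
   around the ring, each threshold is crossed upwards and downwards equally often,
   so that the total variation along these moves vanishes. The mass of the positive
   part of [F(wx)] is such a function, hence the moves cause no cancellation; so is
   the indicator of [F_mu(wx) <= 0], hence the words on which [F(wx)] is positive
   do not depend on [w] and are closed under sorting of descents. If there are any,
   [lam] is one of them, and the same holds for the negative part. Therefore
   [|F_mu| <= |Pi|], and a bounded rational function of R converges. *)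

(** * Actions of permutations on tuples and words *)

Section Actions.
Variable n : nat.
Implicit Types (v w : 'S_n) (i j : 'I_n) (mu : seq nat).

Lemma act_tupleM (T : Type) v w (x : 'I_n -> T) :
  act_tuple w (act_tuple v x) = act_tuple (v * w)%g x.
Proof. by apply/funext => j; rewrite /act_tuple invMg permM. Qed.

Lemma act_tuple1 (T : Type) (x : 'I_n -> T) : act_tuple 1%g x = x.
Proof. by apply/funext => j; rewrite /act_tuple invg1 perm1. Qed.

Lemma act_tuple_sbar_id (T : Type) i (x : 'I_n -> T) :
  x i = x (ordS i) -> act_tuple (sbar i) x = x.
Proof.
by move=> e; apply/funext => j; rewrite /act_tuple tpermV; case: tpermP => [->|->|].
Qed.

Lemma mulg_sbarK w i : (w * sbar i * sbar i)%g = w.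
Proof. by rewrite -mulgA tperm2 mulg1. Qed.

Lemma mulg_sbarVL w i : (w * sbar i)^-1%g i = w^-1%g (ordS i).
Proof. by rewrite invMg permM tpermV tpermL. Qed.

Lemma mulg_sbarVR w i : (w * sbar i)^-1%g (ordS i) = w^-1%g i.
Proof. by rewrite invMg permM tpermV tpermR. Qed.

Lemma nth_act_word w mu j : nth 0%N (act_word w mu) j = nth 0%N mu (w^-1%g j).
Proof. by rewrite (nth_map j) ?size_enum_ord // nth_ord_enum. Qed.

Lemma nth_act_word_sbarL i mu :
  nth 0%N (act_word (sbar i) mu) i = nth 0%N mu (ordS i).
Proof. by rewrite nth_act_word tpermV tpermL. Qed.

Lemma nth_act_word_sbarR i mu :
  nth 0%N (act_word (sbar i) mu) (ordS i) = nth 0%N mu i.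
Proof. by rewrite nth_act_word tpermV tpermR. Qed.

Lemma act_wordM v w mu : act_word w (act_word v mu) = act_word (v * w)%g mu.
Proof. by apply: eq_map => j; rewrite nth_act_word invMg permM. Qed.

Lemma act_word1 mu : size mu = n -> act_word (1%g : 'S_n) mu = mu.
Proof.
move=> sz; have szw : size (act_word (1%g : 'S_n) mu) = n.
  by rewrite size_map size_enum_ord.
apply: (@eq_from_nth _ 0%N) => [|j]; rewrite szw // => jn.
by rewrite (nth_act_word _ _ (Ordinal jn)) invg1 perm1.
Qed.

Lemma perm_act_word w mu : size mu = n -> perm_eq (act_word w mu) mu.
Proof.
move=> sz; rewrite -[X in perm_eq _ X](act_word1 sz) /act_word.
under [X in perm_eq _ X]eq_map do rewrite invg1 perm1.
rewrite (map_comp (fun j : 'I_n => nth 0%N mu j)); apply: perm_map.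
apply: uniq_perm => [||j].
- by rewrite (map_inj_uniq (@perm_inj _ _)) enum_uniq.
- exact: enum_uniq.
- by rewrite mem_enum; apply/mapP; exists (w j); rewrite ?mem_enum ?permK.
Qed.

Lemma gen_sbar : <<[set sbar i | i : 'I_n]%SET>>%g = [set: 'S_n]%SET.
Proof.
case: n => [|[|m]].
- by apply/setP => w; rewrite inE (_ : w = 1%g) ?group1 //; apply/permP => -[].
- apply/setP => w; rewrite inE (_ : w = 1%g) ?group1 //.
  by apply/permP => j; rewrite !ord1.
- rewrite -(@gen_tperm_step _ (inord 1)); last by rewrite inordK // coprimen1.
  congr generated; apply: eq_imset => i; congr tperm.
  by apply/ord_inj; rewrite /= inordK // addn1.
Qed.

Lemma sbar_invariant_const (T : Type) (f : 'S_n -> T) :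
  (forall w i, f (w * sbar i)%g = f w) -> forall w, f w = f 1%g.
Proof.
move=> f_sbar; pose G := [set v : 'S_n | `[< forall w, f (w * v)%g = f w >]]%SET.
have G_group : group_set G.
  apply/group_setP; split; first by rewrite inE; apply/asboolP => w; rewrite mulg1.
  move=> u v; rewrite !inE => /asboolP fu /asboolP fv; apply/asboolP => w.
  by rewrite mulgA fv fu.
have : <<[set sbar i | i : 'I_n]%SET>>%g \subset Group G_group.
  rewrite gen_subG; apply/fintype.subsetP => _ /imsetP[i _ ->].
  by rewrite inE; apply/asboolP => w.
move=> /fintype.subsetP sub w; have := sub w; rewrite gen_sbar !inE => /(_ isT).
by move=> /asboolP /(_ 1%g); rewrite mul1g.
Qed.

End Actions.

Lemma exists_perm2 (T : finType) (a b c d : T) : a != b -> c != d ->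
  exists w : {perm T}, w a = c /\ w b = d.
Proof.
move=> ab cd; exists (tperm a c * tperm (tperm a c b) d)%g.
split; last by rewrite permM tpermL.
rewrite permM tpermL tpermD // 1?eq_sym //.
by rewrite -[X in X != _](tpermL a c) (inj_eq perm_inj).
Qed.

(** * Balance of entries and exits around the ring *)

Section RingBalance.
Variable n : nat.
Implicit Types (P : pred 'I_n) (w : 'S_n) (i : 'I_n).

Definition entry P w i := ~~ P (w^-1%g i) && P (w^-1%g (ordS i)).

Lemma card_entry_sbar P w :
  #|[set i | entry P (w * sbar i)%g i]%SET| = #|[set i | entry P w i]%SET|.
Proof.
have balance : (\sum_i (entry P (w * sbar i)%g i + P (w^-1%g (ordS i))) =
    \sum_i (entry P w i + P (w^-1%g i)))%N.
  apply: eq_bigr => i _; rewrite /entry mulg_sbarVL mulg_sbarVR.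
  by case: (P _); case: (P _).
have shift : (\sum_i P (w^-1%g (ordS i)) = \sum_i P (w^-1%g i))%N.
  by rewrite [RHS](reindex_inj (@ordS_inj n)).
have card_sum (Q : pred 'I_n) : #|[set i | Q i]%SET| = (\sum_i Q i)%N.
  by rewrite -sum1dep_card big_mkcond; apply: eq_bigr => i _; case: (Q i).
by move: balance; rewrite !big_split /= shift -!card_sum => /addIn.
Qed.

Lemma sum_entry_sbar (V : nmodType) P (f : 'S_n -> V) :
  \sum_w \sum_(i | entry P w i) f (w * sbar i)%g =
  \sum_w \sum_(i | entry P w i) f w.
Proof.
transitivity (\sum_w \sum_(i | entry P (w * sbar i)%g i) f w).
  under eq_bigr do rewrite big_mkcond; under [RHS]eq_bigr do rewrite big_mkcond.
  rewrite exchange_big [RHS]exchange_big; apply: eq_bigr => i _ /=.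
  rewrite (reindex_inj (mulIg (sbar i))) /=.
  by apply: eq_bigr => w _; rewrite mulg_sbarK.
apply: eq_bigr => w _; rewrite !sumr_const.
by rewrite -[in LHS]cardsE -[in RHS]cardsE card_entry_sbar.
Qed.

(* Every threshold is crossed upwards as often as downwards, so the total
   decrease of [f] across it vanishes. *)
Lemma antitone_ascents_const d (T : orderType d) (V : numDomainType)
    (x : 'I_n -> T) (f : 'S_n -> V) :
  (forall w i, (act_tuple w x i <= act_tuple w x (ordS i))%O ->
    f (w * sbar i)%g <= f w) ->
  forall w, f w = f 1%g.
Proof.
move=> f_le; have f_lt w i :
    (act_tuple w x i < act_tuple w x (ordS i))%O -> f (w * sbar i)%g = f w.
  move=> xi; pose P : pred 'I_n := fun j => (x (w^-1%g (ordS i)) <= x j)%O.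
  have entry_le v j : entry P v j -> 0 <= f v - f (v * sbar j)%g.
    rewrite /entry /P -ltNge => /andP[/ltW le1 le2].
    by rewrite subr_ge0; apply/f_le/(le_trans le1).
  have total0 : \sum_v \sum_(j | entry P v j) (f v - f (v * sbar j)%g) = 0.
    under eq_bigr do rewrite sumrB.
    by rewrite sumrB sum_entry_sbar subrr.
  have decrease0 : \sum_(j | entry P w j) (f w - f (w * sbar j)%g) = 0.
    by apply: (psumr_eq0P _ total0) => // v _; apply/sumr_ge0/entry_le.
  apply/esym/eqP; rewrite -subr_eq0; apply/eqP.
  by apply: (psumr_eq0P (entry_le w) decrease0); rewrite /entry /P -ltNge xi lexx.
apply: sbar_invariant_const => w i.
case: (ltgtP (act_tuple w x i) (act_tuple w x (ordS i))) => xi.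
- exact: f_lt.
- rewrite -[in RHS](mulg_sbarK w i) [RHS]f_lt //.
  by rewrite /act_tuple mulg_sbarVL mulg_sbarVR.
- apply: le_anti; rewrite f_le ?xi //= -[X in f X <= _](mulg_sbarK w i) f_le //.
  by rewrite /act_tuple mulg_sbarVL mulg_sbarVR -!/(act_tuple _ _ _) xi.
Qed.

End RingBalance.

(** * Rearrangements of a word and sorting of descents *)

Section Rearrangements.
Variables (n : nat) (lam : seq nat).
Hypothesis size_lam : size lam = n.
Local Notation S := (permutations lam).
Implicit Types (v w : 'S_n) (i : 'I_n) (mu nu : seq nat).

Lemma size_rearrangement mu : mu \in S -> size mu = n.
Proof. by rewrite mem_permutations => /perm_size ->. Qed.

Lemma mem_act_word w mu : mu \in S -> act_word w mu \in S.
Proof.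
move=> muS; have sz := size_rearrangement muS; move: muS.
by rewrite !mem_permutations; apply: perm_trans; apply: perm_act_word.
Qed.

Lemma act_wordK v w mu : (v * w = 1)%g -> mu \in S ->
  act_word w (act_word v mu) = mu.
Proof. by move=> e muS; rewrite act_wordM e act_word1 ?size_rearrangement. Qed.

Lemma act_word_sbarK i mu : mu \in S ->
  act_word (sbar i) (act_word (sbar i) mu) = mu.
Proof. by apply: act_wordK; rewrite tperm2. Qed.

Lemma eq_act_word_sbar i mu nu : mu \in S -> nu \in S ->
  (nu == act_word (sbar i) mu) = (mu == act_word (sbar i) nu).
Proof. by move=> muS nuS; apply/eqP/eqP => ->; rewrite act_word_sbarK. Qed.

Lemma reindex_act_word (V : nmodType) w (g : seq nat -> V) :
  \sum_(mu <- S) g (act_word w mu) = \sum_(mu <- S) g mu.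
Proof.
rewrite -(big_map (act_word w) xpredT g); apply: perm_big.
have act_inj : {in S &, injective (act_word w)}.
  move=> mu nu muS nuS /(congr1 (act_word w^-1%g)).
  by rewrite !act_wordK ?mulgV.
apply: uniq_perm; rewrite ?map_inj_in_uniq ?permutations_uniq // => mu.
apply/mapP/idP => [[nu nuS ->]|muS]; first exact: mem_act_word.
exists (act_word w^-1%g mu); first exact: mem_act_word.
by rewrite act_wordK ?mulVg.
Qed.

Lemma sum_rearrangements_eq (V : nmodType) nu (g : seq nat -> V) : nu \in S ->
  \sum_(mu <- S) (if nu == mu then g mu else 0) = g nu.
Proof.
move=> nuS; rewrite (bigD1_seq nu) ?permutations_uniq //= eqxx.
by rewrite big1 ?addr0 // => mu; rewrite eq_sym => /negPf ->.
Qed.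

Definition descent mu i : bool := (nth 0%N mu (ordS i) < nth 0%N mu i)%N.

Lemma descent_sbar mu i :
  descent (act_word (sbar i) mu) i = (nth 0%N mu i < nth 0%N mu (ordS i))%N.
Proof. by rewrite /descent nth_act_word_sbarL nth_act_word_sbarR. Qed.

Definition moment mu : nat := (\sum_(j < n) j * nth 0%N mu j)%N.

Lemma moment_sort_descent i mu : (i.+1 < n)%N -> descent mu i ->
  (moment mu < moment (act_word (sbar i) mu))%N.
Proof.
move=> i_n desc; have iS : ordS i = i.+1 :> nat by rewrite /= modn_small.
have ne : ordS i != i by apply/eqP => /(congr1 (@nat_of_ord n)); rewrite iS; lia.
have split_sum (f : 'I_n -> nat) : (\sum_(j < n) j * f j =
    i * f i + i.+1 * f (ordS i) + \sum_(j < n | (j != i) && (j != ordS i)) j * f j)%N.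
  by rewrite -iS (bigD1 i) // (bigD1 (ordS i)) // -addnA.
rewrite /moment !split_sum nth_act_word_sbarL nth_act_word_sbarR.
rewrite [X in (_ < _ + X)%N](eq_bigr (fun j : 'I_n => j * nth 0%N mu j)%N).
  by rewrite ltn_add2r; move: desc; rewrite /descent; nia.
by move=> j /andP[ji jSi]; rewrite nth_act_word tpermV tpermD // eq_sym.
Qed.

Lemma unsorted_descent mu : size mu = n -> ~~ sorted leq mu ->
  exists2 i : 'I_n, (i.+1 < n)%N & descent mu i.
Proof.
move=> sz unsorted; apply: contrapT => no_descent; case/negP: unsorted.
apply/(sortedP 0%N) => j; rewrite sz => jn; rewrite leqNgt; apply/negP => lt.
apply: no_descent; exists (Ordinal (ltnW jn)) => //.
by rewrite /descent /= modn_small.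
Qed.

Lemma sort_descents (Q : seq nat -> Prop) : sorted leq lam ->
  (forall mu i, mu \in S -> descent mu i -> Q mu -> Q (act_word (sbar i) mu)) ->
  forall mu, mu \in S -> Q mu -> Q lam.
Proof.
move=> lam_sorted Q_sort mu.
pose bound := (\sum_(nu <- S) moment nu)%N.
have moment_le nu : nu \in S -> (moment nu <= bound)%N.
  by move=> nuS; rewrite /bound (bigD1_seq nu) ?permutations_uniq //= leq_addr.
have [k] := ubnP (bound - moment mu)%N; elim: k mu => // k IH mu lt_k muS Qmu.
have [mu_sorted|] := boolP (sorted leq mu).
  by rewrite -(sorted_eq leq_trans anti_leq mu_sorted lam_sorted) -?mem_permutations.
move=> /(unsorted_descent (size_rearrangement muS))[i i_n desc].
have muS' := mem_act_word (sbar i) muS.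
apply: (IH _ _ muS'); last exact: Q_sort.
by have := moment_sort_descent i_n desc; have := moment_le _ muS'; lia.
Qed.

End Rearrangements.

(** * Random sorting of one descent *)

Section SortStep.
Variables (n : nat) (R : realFieldType) (lam : seq nat) (i : 'I_n) (q : nat -> R).
Hypothesis size_lam : size lam = n.
Local Notation S := (permutations lam).
Implicit Types (mu nu : seq nat) (v : seq nat -> R).

Definition sort_prob mu : R := if descent mu i then q (nth 0%N mu i) else 0.

Definition sort_kernel mu nu : R :=
  (if nu == mu then 1 - sort_prob mu else 0)
  + (if nu == act_word (sbar i) mu then sort_prob mu else 0).

Definition sort_step v nu : R :=
  (1 - sort_prob nu) * v nu
  + sort_prob (act_word (sbar i) nu) * v (act_word (sbar i) nu).

Lemma sum_sort_kernel v nu : nu \in S ->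
  \sum_(mu <- S) v mu * sort_kernel mu nu = sort_step v nu.
Proof.
move=> nuS; have nuS' := mem_act_word size_lam (sbar i) nuS.
rewrite /sort_step -(sum_rearrangements_eq (fun mu => (1 - sort_prob mu) * v mu) nuS).
rewrite -(sum_rearrangements_eq (fun mu => sort_prob mu * v mu) nuS') -big_split /=.
apply: eq_big_seq => mu muS.
rewrite /sort_kernel (eq_act_word_sbar size_lam) // (eq_sym mu).
by case: ifP => _; case: ifP => _; ring.
Qed.

Lemma sum_sort_step v : \sum_(nu <- S) sort_step v nu = \sum_(nu <- S) v nu.
Proof.
rewrite big_split /= (reindex_act_word size_lam _ (fun nu => sort_prob nu * v nu)).
by rewrite -big_split; apply: eq_bigr => nu _ /=; ring.
Qed.

Hypothesis q_bounds : forall k, 0 <= q k < 1.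

Lemma sort_prob_bounds mu : 0 <= sort_prob mu < 1.
Proof. by rewrite /sort_prob; case: ifP => _; rewrite ?lexx ?ltr01. Qed.

Lemma sort_step_max0_le v mu :
  Num.max (sort_step v mu) 0 <= sort_step (fun nu => Num.max (v nu) 0) mu.
Proof.
rewrite /sort_step; set mu' := act_word _ _.
have /andP[stay0 /ltW stay1] := sort_prob_bounds mu.
have /andP[move0 _] := sort_prob_bounds mu'.
rewrite -subr_ge0 in stay1; rewrite ge_max; apply/andP; split.
  by apply: lerD; rewrite ler_wpM2l // le_max lexx.
by rewrite addr_ge0 // mulr_ge0 // le_max lexx orbT.
Qed.

Lemma sort_step_gt0_stay v mu : (forall nu, 0 <= v nu) -> 0 < v mu ->
  0 < sort_step v mu.
Proof.
move=> v0 vmu; have /andP[_ stay1] := sort_prob_bounds mu.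
have /andP[move0 _] := sort_prob_bounds (act_word (sbar i) mu).
by rewrite ltr_pwDl ?mulr_ge0 // mulr_gt0 // subr_gt0.
Qed.

Lemma sort_step_gt0_move v mu : mu \in S -> (forall nu, 0 <= v nu) ->
  descent mu i -> (forall k, 0 < q k) -> 0 < v mu ->
  0 < sort_step v (act_word (sbar i) mu).
Proof.
move=> muS v0 desc q0 vmu; rewrite /sort_step (act_word_sbarK size_lam) //.
have /andP[_ /ltW stay1] := sort_prob_bounds (act_word (sbar i) mu).
by rewrite ltr_wpDl ?mulr_ge0 ?subr_ge0 // mulr_gt0 // /sort_prob desc.
Qed.

End SortStep.

Lemma nneg_share_bounds (R : realFieldType) (I : eqType) (s : seq I)
    (f : I -> R) (i : I) : uniq s -> i \in s ->
  {in s, forall j, 0 <= f j} -> 0 <= f i / \sum_(j <- s) f j <= 1.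
Proof.
move=> s_uniq si f0; rewrite (bigD1_seq i) //=.
have rest0 : 0 <= \sum_(j <- s | j != i) f j.
  by rewrite big_seq_cond; apply: sumr_ge0 => j /andP[/f0].
have fi0 := f0 _ si.
rewrite divr_ge0 ?addr_ge0 //=.
have [->|ne] := eqVneq (f i + \sum_(j <- s | j != i) f j) 0.
  by rewrite invr0 mulr0 ler01.
rewrite ler_pdivrMr ?lt_neqAle ?(eq_sym 0) ?ne ?addr_ge0 //.
by rewrite mul1r lerDl.
Qed.

(** * The exchange relations as random sorting *)

Section ExchangeLaw.
Variables (n : nat) (R : realType) (a : nat -> R) (lam : seq nat).
Hypothesis a01 : forall k, 0 < a k < 1.
Hypothesis size_lam : size lam = n.
Local Notation S := (permutations lam).
Implicit Types (i : 'I_n) (x : 'I_n -> R) (F : ('I_n -> R) -> seq nat -> R).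

Definition exchange_prob i x (k : nat) : R :=
  a k * (x (ordS i) - x i) / (x i * (x (ordS i) - a k)).

Definition exchange_law F : Prop :=
  forall i x mu, (forall j, 1 <= x j) -> mu \in S ->
  F (act_tuple (sbar i) x) mu = sort_step i (exchange_prob i x) (F x) mu.

Lemma exchange_lawN F : exchange_law F -> exchange_law (fun x mu => - F x mu).
Proof. by move=> FE i x mu x1 muS; rewrite FE // /sort_step; ring. Qed.

Lemma exchange_denominator_neq0 x i k : (forall j, 1 <= x j) ->
  (x i != 0) * (x (ordS i) - a k != 0).
Proof.
move=> x1; have /andP[_ ak] := a01 k; have := x1 i; have := x1 (ordS i).
by move=> *; split; lra.
Qed.

Lemma exchange_prob_bounds x i k : (forall j, 1 <= x j) -> x i <= x (ordS i) ->
  0 <= exchange_prob i x k < 1.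
Proof.
move=> x1 xi; rewrite /exchange_prob; have /andP[a0 ak] := a01 k.
have := x1 i; have := x1 (ordS i) => x1S x1i.
have den0 : 0 < x i * (x (ordS i) - a k) by apply: mulr_gt0; lra.
by rewrite ltr_pdivrMr // divr_ge0 //=; nra.
Qed.

Lemma exchange_prob_gt0 x i k : (forall j, 1 <= x j) -> x i < x (ordS i) ->
  0 < exchange_prob i x k.
Proof.
move=> x1 xi; rewrite /exchange_prob; have /andP[a0 ak] := a01 k.
have := x1 i; have := x1 (ordS i) => x1S x1i.
by rewrite divr_gt0 ?mulr_gt0 //; lra.
Qed.

Section TASEPPolynomials.
Variable Psi : seq nat -> mpoly.mpoly n R.
Hypothesis Psi_iTASEP : is_iTASEP_family a lam Psi.

Lemma iTASEP_swap_ascent i x mu : (forall j, 1 <= x j) -> mu \in S ->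
  (nth 0%N mu i < nth 0%N mu (ordS i))%N ->
  ev (act_tuple (sbar i) x) (Psi mu) =
  ev x (Psi mu) + exchange_prob i x (nth 0%N mu (ordS i))
    * ev x (Psi (act_word (sbar i) mu)).
Proof.
move=> x1 muS asc; have [/(_ i x asc) + _ _] := Psi_iTASEP muS.
set k := nth 0%N mu _; set F := ev x (Psi mu); set G := ev _ (Psi mu).
set F' := ev x _ => rel.
have [xi0 xSk] := exchange_denominator_neq0 i k x1.
rewrite /exchange_prob; apply: (mulfI (mulf_neq0 xi0 xSk)).
transitivity (x i * (x (ordS i) - a k) * F - x i * (x (ordS i) - a k) * (F - G)).
  by ring.
by rewrite rel; field; rewrite xi0 xSk.
Qed.

(* Apply the relation of the sorted word at [x] and at the swapped point. *)
Lemma iTASEP_swap_descent i x mu : (forall j, 1 <= x j) -> mu \in S ->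
  descent mu i ->
  ev (act_tuple (sbar i) x) (Psi mu) =
  (1 - exchange_prob i x (nth 0%N mu i)) * ev x (Psi mu).
Proof.
move=> x1 muS desc; rewrite /exchange_prob; set k := nth 0%N mu i.
have [e|ne] := eqVneq (x i) (x (ordS i)).
  by rewrite act_tuple_sbar_id // e subrr mulr0 mul0r; ring.
have [xi0 xSk] := exchange_denominator_neq0 i k x1.
have /andP[ak0 _] := a01 k.
have muS' := mem_act_word size_lam (sbar i) muS.
have [/(_ i) rel _ _] := Psi_iTASEP muS'.
have xS : act_tuple (sbar i) x (ordS i) = x i by rewrite /act_tuple tpermV tpermR.
have xi : act_tuple (sbar i) x i = x (ordS i) by rewrite /act_tuple tpermV tpermL.
move: rel; rewrite nth_act_word_sbarL nth_act_word_sbarR (act_word_sbarK size_lam) //.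
move=> rel; have := rel (act_tuple (sbar i) x) desc; have := rel x desc.
rewrite xS xi act_tupleM tperm2 act_tuple1 -/k.
set D := ev x (Psi (act_word _ _)); set D' := ev _ (Psi (act_word _ _)).
set F := ev x (Psi mu); set G := ev _ (Psi mu) => relx relsx.
have c0 : a k * (x i - x (ordS i)) != 0 by rewrite mulf_neq0 ?subr_eq0 // gt_eqF.
have cross_mul : x i * (x (ordS i) - a k) * G = x (ordS i) * (x i - a k) * F.
  apply: (mulfI c0); transitivity
    (x (ordS i) * (x i - a k) * (x i * (x (ordS i) - a k) * (D - D'))).
    transitivity (- (x i * (x (ordS i) - a k) * (a k * (x (ordS i) - x i) * G))).
      by ring.
    by rewrite -relsx; ring.
  by rewrite relx; ring.
apply: (mulfI (mulf_neq0 xi0 xSk)); rewrite cross_mul.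
by field; rewrite xi0 xSk.
Qed.

Lemma iTASEP_exchange_law : exchange_law (fun x mu => ev x (Psi mu)).
Proof.
move=> i x mu x1 muS.
rewrite /sort_step /sort_prob descent_sbar nth_act_word_sbarL /descent.
case: ltngtP => [desc|asc|e].
- by rewrite iTASEP_swap_descent // mul0r addr0.
- by rewrite iTASEP_swap_ascent // subr0 mul1r.
- have [_ /(_ i x (esym e)) -> _] := Psi_iTASEP muS; ring.
Qed.

End TASEPPolynomials.

Section SignDefinite.
Variables (F : ('I_n -> R) -> seq nat -> R) (x : 'I_n -> R).
Hypothesis F_exchange : exchange_law F.
Hypothesis x_ge1 : forall j, 1 <= x j.
Implicit Types (w : 'S_n) (j m : 'I_n) (mu : seq nat).

Lemma exchange_law_sum w :
  \sum_(mu <- S) F (act_tuple w x) mu = \sum_(mu <- S) F x mu.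
Proof.
rewrite -[in RHS](act_tuple1 x).
apply: (sbar_invariant_const (f := fun v => \sum_(mu <- S) F (act_tuple v x) mu)).
move=> v i; rewrite -[RHS](sum_sort_step i (exchange_prob i (act_tuple v x)) size_lam).
by apply: eq_big_seq => mu muS; rewrite -act_tupleM F_exchange // => j; apply: x_ge1.
Qed.

Definition pos_part w mu : R := Num.max (F (act_tuple w x) mu) 0.

Lemma pos_part_ge0 w mu : 0 <= pos_part w mu.
Proof. by rewrite le_max lexx orbT. Qed.

Lemma pos_part_sbar_le w i mu : mu \in S ->
  act_tuple w x i <= act_tuple w x (ordS i) ->
  pos_part (w * sbar i)%g mu <=
  sort_step i (exchange_prob i (act_tuple w x)) (pos_part w) mu.
Proof.
move=> muS xi; have wx1 j : 1 <= act_tuple w x j by apply: x_ge1.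
rewrite {1}/pos_part -act_tupleM F_exchange //.
by apply: sort_step_max0_le => k; apply: exchange_prob_bounds.
Qed.

Lemma sum_pos_part_sbar_le w i : act_tuple w x i <= act_tuple w x (ordS i) ->
  \sum_(mu <- S) pos_part (w * sbar i)%g mu <= \sum_(mu <- S) pos_part w mu.
Proof.
move=> xi.
rewrite -(sum_sort_step i (exchange_prob i (act_tuple w x)) size_lam (pos_part w)).
by rewrite big_seq [leRHS]big_seq; apply: ler_sum => mu muS; apply: pos_part_sbar_le.
Qed.

(* Cancellation would lose positive mass, but the total is constant. *)
Lemma pos_part_sbar w i mu : mu \in S ->
  act_tuple w x i <= act_tuple w x (ordS i) ->
  pos_part (w * sbar i)%g mu =
  sort_step i (exchange_prob i (act_tuple w x)) (pos_part w) mu.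
Proof.
move=> muS xi.
pose loss nu := sort_step i (exchange_prob i (act_tuple w x)) (pos_part w) nu
  - pos_part (w * sbar i)%g nu.
have : \sum_(nu <- S) loss nu = 0.
  rewrite sumrB (sum_sort_step _ _ size_lam).
  have total := antitone_ascents_const sum_pos_part_sbar_le.
  by rewrite total [X in _ - X]total subrr.
rewrite big_seq => /eqP; rewrite psumr_eq0 => [|nu nuS].
  by move=> /allP /(_ mu muS); rewrite muS subr_eq0 => /eqP.
by rewrite subr_ge0 pos_part_sbar_le.
Qed.

Lemma pos_part_gt0_const w mu : mu \in S ->
  (0 < pos_part w mu) = (0 < pos_part 1%g mu).
Proof.
move=> muS.
suff /(_ w)/eqP : forall v,
    (pos_part v mu <= 0)%R%:R = (pos_part 1%g mu <= 0)%R%:R :> R.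
  by rewrite eqr_nat !ltNge; do 2 case: (_ <= _)%R.
apply: (antitone_ascents_const (x := x)) => v i xi.
rewrite ler_nat; have [_|pos_v] := leP (pos_part v mu); first exact: leq_b1.
rewrite leqn0 eqb0 -ltNge pos_part_sbar //; apply: sort_step_gt0_stay => // [k|nu].
  by apply: exchange_prob_bounds => // j; apply: x_ge1.
exact: pos_part_ge0.
Qed.

Lemma pos_part_gt0_sort i j m mu : x j < x m -> mu \in S -> descent mu i ->
  0 < pos_part 1%g mu -> 0 < pos_part 1%g (act_word (sbar i) mu).
Proof.
move=> xjm muS desc pos_mu; have muS' := mem_act_word size_lam (sbar i) muS.
have jm : j != m by apply: contraTneq xjm => ->; rewrite ltxx.
have iS : i != ordS i by apply: contraTneq desc => e; rewrite /descent -e ltnn.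
have [w [wj wm]] := exists_perm2 jm iS.
have wx_lt : act_tuple w x i < act_tuple w x (ordS i).
  by rewrite /act_tuple -wm -wj !permK.
rewrite -(pos_part_gt0_const (w * sbar i)%g) // pos_part_sbar ?ltW //.
apply: (sort_step_gt0_move size_lam) => // [k|nu|k|].
- by apply: exchange_prob_bounds; [move=> l; apply: x_ge1|exact: ltW].
- exact: pos_part_ge0.
- by apply: exchange_prob_gt0 => // l; apply: x_ge1.
- by rewrite pos_part_gt0_const.
Qed.

Hypothesis lam_sorted : sorted leq lam.

Lemma exchange_law_gt0_sorted j m mu : x j < x m -> mu \in S ->
  0 < F x mu -> 0 < F x lam.
Proof.
have pos1 nu : (0 < pos_part 1%g nu) = (0 < F x nu).
  by rewrite /pos_part lt_max ltxx orbF act_tuple1.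
rewrite -!pos1 => xjm; move: mu.
apply: (sort_descents size_lam (Q := fun nu => 0 < pos_part 1%g nu)) => // nu i.
exact: (pos_part_gt0_sort xjm).
Qed.

End SignDefinite.

Lemma exchange_law_same_sign F x j m : exchange_law F -> sorted leq lam ->
  (forall l, 1 <= x l) -> x j < x m ->
  {in S, forall mu, 0 <= F x mu} \/ {in S, forall mu, 0 <= - F x mu}.
Proof.
move=> FE lam_sorted x1 xjm; apply: contrapT => /not_orP[].
move=> /existsNP[mu /not_implyP[muS /negP]]; rewrite -ltNge -oppr_gt0 => Fmu.
move=> /existsNP[nu /not_implyP[nuS /negP]]; rewrite -ltNge oppr_lt0 => Fnu.
have lam_pos := exchange_law_gt0_sorted FE x1 lam_sorted xjm nuS Fnu.
have := exchange_law_gt0_sorted (exchange_lawN FE) x1 lam_sorted xjm muS Fmu.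
by rewrite oppr_gt0 => /(lt_trans lam_pos); rewrite ltxx.
Qed.

Lemma exchange_law_share_bounds F x j m mu : exchange_law F ->
  sorted leq lam -> (forall l, 1 <= x l) -> x j < x m -> mu \in S ->
  0 <= F x mu / \sum_(nu <- S) F x nu <= 1.
Proof.
move=> FE lam_sorted x1 xjm muS.
have [F0|F0] := exchange_law_same_sign FE lam_sorted x1 xjm.
  exact: nneg_share_bounds (permutations_uniq _) muS F0.
have := nneg_share_bounds (permutations_uniq _) muS F0.
by rewrite sumrN invrN mulrNN.
Qed.

End ExchangeLaw.

(** * Stones on the ring *)

Section Rotations.
Implicit Types s t u : seq nat.

Lemma cyc_eqP s t : reflect (exists k, s = rot k t) (cyc_eq s t).
Proof.
apply: (iffP hasP) => [[k _ /eqP ->]|[k ->]]; first by exists k.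
have [kt|tk] := leqP k (size t); first by exists k; rewrite ?mem_iota ?ltnS.
by exists 0%N; rewrite ?mem_iota // rot0 rot_oversize // ltnW.
Qed.

Lemma cyc_eq_sym s t : cyc_eq s t -> cyc_eq t s.
Proof.
move=> /cyc_eqP[k ->]; apply/cyc_eqP; exists (size (rot k t) - k)%N.
by rewrite -/(rotr _ _) rotK.
Qed.

Lemma cyc_eq_trans s t u : cyc_eq s t -> cyc_eq t u -> cyc_eq s u.
Proof.
move=> /cyc_eqP[k ->] /cyc_eqP[l ->]; apply/cyc_eqP.
by rewrite rot_rot_add; eexists.
Qed.

Lemma cyc_eq_filter_rot (T : Type) (P : pred T) (g : T -> nat) k (s : seq T) :
  cyc_eq [seq g j | j <- rot k s & P j] [seq g j | j <- s & P j].
Proof.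
apply/cyc_eqP; exists (size (seq.filter P (take k s))).
rewrite -{3}(cat_take_drop k s) filter_cat.
by rewrite -map_rot rot_size_cat -filter_cat.
Qed.

End Rotations.

Lemma filter_swap (T : Type) (P : pred T) (a b : T) (s : seq T) :
  ~~ (P a && P b) -> seq.filter P [:: a, b & s] = seq.filter P [:: b, a & s].
Proof. by rewrite /=; case: (P a); case: (P b). Qed.

Lemma rot_enum_ord n (i : 'I_n) : (1 < n)%N ->
  exists e, rot i (enum 'I_n) = i :: ordS i :: e.
Proof.
move=> n1; have sz := size_enum_ord n.
rewrite /rot (drop_nth i) ?sz // nth_ord_enum.
have [iS|iS] := ltnP i.+1 n.
  rewrite (drop_nth i) ?sz //; eexists; congr (_ :: (_ :: _)).
  by apply/ord_inj; rewrite nth_enum_ord //= modn_small.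
have ei : i.+1 = n by apply/eqP; rewrite eqn_leq iS ltn_ord.
rewrite drop_oversize ?sz //= -(drop0 (enum 'I_n)) (drop_nth i) ?sz ?(ltnW n1) //.
have -> : nat_of_ord i = n.-2.+1 by lia.
eexists; congr (_ :: (_ :: _)).
by apply/ord_inj; rewrite nth_enum_ord ?(ltnW n1) //= ei modnn.
Qed.

Section Stones.
Variables (n : nat) (rho : 'I_n -> nat).
Implicit Types (sigma : 'S_n) (i : 'I_n).

Lemma stones_alongE d sigma : stones_along rho d sigma =
  [seq nat_of_ord j | j <- [seq sigma^-1%g i | i <- enum 'I_n] & rho j == d].
Proof. by rewrite filter_map -map_comp. Qed.

Lemma up_sbar sigma i : up rho (sigma * sbar i)%g i =
  (rho (sigma^-1%g (ordS i)) < rho (sigma^-1%g i))%N.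
Proof. by rewrite /up mulg_sbarVL mulg_sbarVR. Qed.

Lemma Omega1 : 1%g \in Omega rho.
Proof.
have refl d : cyc_eq (stones_along rho d 1%g) (stones_of rho d).
  apply/cyc_eqP; exists 0%N; rewrite rot0 stones_alongE /stones_of.
  by rewrite (@eq_map _ _ _ id) ?map_id // => j; rewrite invg1 perm1.
by rewrite inE !refl.
Qed.

Hypothesis n_gt1 : (1 < n)%N.

Lemma stones_along_sbar d sigma i :
  rho (sigma^-1%g i) != rho (sigma^-1%g (ordS i)) ->
  cyc_eq (stones_along rho d (sigma * sbar i)%g) (stones_along rho d sigma).
Proof.
move=> ne; have [e rotE] := rot_enum_ord i n_gt1.
have : uniq (rot i (enum 'I_n)) by rewrite rot_uniq enum_uniq.
rewrite rotE /= inE negb_or => /and3P[/andP[_ ie] Se _].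
have swapped : [seq (sigma * sbar i)^-1%g j | j <- rot i (enum 'I_n)] =
    [:: sigma^-1%g (ordS i), sigma^-1%g i & [seq sigma^-1%g j | j <- e]].
  rewrite rotE /= mulg_sbarVL mulg_sbarVR; congr [:: _, _ & _].
  apply/eq_in_map => j je; rewrite invMg permM tpermV tpermD //.
    by apply: contraNneq ie => ->.
  by apply: contraNneq Se => ->.
rewrite !stones_alongE.
apply: cyc_eq_trans (cyc_eq_sym (cyc_eq_filter_rot _ _ i _)) _.
rewrite -map_rot swapped filter_swap; last first.
  by apply: contra ne => /andP[/eqP -> /eqP ->].
have -> : [:: sigma^-1%g i, sigma^-1%g (ordS i) & [seq sigma^-1%g j | j <- e]] =
    rot i [seq sigma^-1%g j | j <- enum 'I_n] by rewrite -map_rot rotE.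
exact: cyc_eq_filter_rot.
Qed.

Lemma Omega_sbar sigma i : rho (sigma^-1%g i) != rho (sigma^-1%g (ordS i)) ->
  sigma \in Omega rho -> (sigma * sbar i)%g \in Omega rho.
Proof.
move=> ne; rewrite !inE => /andP[cyc1 cyc2].
by apply/andP; split; apply: cyc_eq_trans (stones_along_sbar _ ne) _.
Qed.

Hypothesis rho12 : forall j, (rho j == 1)%N || (rho j == 2)%N.

Lemma up_densities sigma i : up rho sigma i ->
  rho (sigma^-1%g i) = 1%N /\ rho (sigma^-1%g (ordS i)) = 2%N.
Proof.
rewrite /up; case/orP: (rho12 (sigma^-1%g i)) => /eqP ->;
  by case/orP: (rho12 (sigma^-1%g (ordS i))) => /eqP ->.
Qed.

Lemma up_entry sigma i : up rho sigma i = entry [pred j | rho j == 2%N] sigma i.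
Proof.
rewrite /up /entry /=.
by case/orP: (rho12 (sigma^-1%g i)) => /eqP ->;
  case/orP: (rho12 (sigma^-1%g (ordS i))) => /eqP ->.
Qed.

Lemma card_up_sbar sigma :
  #|[set i | up rho (sigma * sbar i)%g i]%SET| = Kfrak rho sigma.
Proof.
transitivity
  #|[set i | entry [pred j | rho j == 2%N] (sigma * sbar i)%g i]%SET|.
  by apply: eq_card => i; rewrite !inE up_entry.
by rewrite card_entry_sbar; apply: eq_card => i; rewrite !inE up_entry.
Qed.

End Stones.

(** * A criterion for stationarity of the stoned chain *)

Section StonedChain.
Variables (R : realType) (n : nat) (a : nat -> R) (lam : seq nat).
Variables (rho : 'I_n -> nat) (p : 'I_n -> R) (L : seq nat -> 'S_n -> R).
Hypothesis n_gt1 : (1 < n)%N.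
Hypothesis size_lam : size lam = n.
Hypothesis rho12 : forall j, (rho j == 1)%N || (rho j == 2)%N.
Local Notation S := (permutations lam).
Implicit Types (sigma : 'S_n) (i : 'I_n) (mu : seq nat).

Definition stone_prob sigma i (k : nat) : R := p (sigma^-1%g i) * a k.

Definition stone_exchange_law : Prop :=
  forall mu sigma i, mu \in S -> sigma \in Omega rho -> up rho sigma i ->
  L mu (sigma * sbar i)%g = sort_step i (stone_prob sigma i) (L^~ sigma) mu.

Hypothesis L_exchange : stone_exchange_law.

Lemma transE mu sigma mu' sigma' : trans rho a p mu sigma mu' sigma' =
  (if sigma' == sigma then
     if mu' == mu then 1 - (Kfrak rho sigma)%:R / n%:R else 0 else 0)
  + \sum_(i | up rho sigma i) (if sigma' == (sigma * sbar i)%g then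
      n%:R^-1 * sort_kernel i (stone_prob sigma i) mu mu' else 0).
Proof.
rewrite /trans; congr (_ + _); first by do 2 case: eqP.
apply: eq_bigr => i _; rewrite /sort_kernel /sort_prob /descent /stone_prob.
by case: (sigma' == _); rewrite ?andbT ?andbF; do ?[case: ifP => _]; ring.
Qed.

Lemma sum_words_trans sigma mu' sigma' : mu' \in S -> sigma \in Omega rho ->
  \sum_(mu <- S) L mu sigma * trans rho a p mu sigma mu' sigma' =
  (if sigma' == sigma then
     (1 - (Kfrak rho sigma')%:R / n%:R) * L mu' sigma' else 0)
  + \sum_(i | up rho sigma i) (if sigma' == (sigma * sbar i)%g then
      n%:R^-1 * L mu' sigma' else 0).
Proof.
move=> muS sigmaO; under eq_bigr do rewrite transE mulrDr mulr_sumr.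
rewrite big_split /= exchange_big /=; congr (_ + _).
  case: eqP => [->|_]; last by rewrite big1 // => mu _; rewrite mulr0.
  rewrite -(sum_rearrangements_eq
    (fun mu => (1 - (Kfrak rho sigma)%:R / n%:R) * L mu sigma) muS).
  by apply: eq_bigr => mu _; case: ifP => _; rewrite ?mulr0 // mulrC.
apply: eq_bigr => i up_i.
case: eqP => [->|_]; last by rewrite big1 // => mu _; rewrite mulr0.
rewrite L_exchange // -(sum_sort_kernel i _ size_lam _ muS) mulr_sumr.
by apply: eq_bigr => mu _; rewrite mulrCA.
Qed.

Lemma sum_Omega_predecessor (c : R) sigma' i : sigma' \in Omega rho ->
  \sum_(sigma in Omega rho)
    (if up rho sigma i && (sigma' == (sigma * sbar i)%g) then c else 0) =
  if up rho (sigma' * sbar i)%g i then c else 0.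
Proof.
move=> sigmaO.
have predE s : (sigma' == (s * sbar i)%g) = (s == (sigma' * sbar i)%g).
  by apply/eqP/eqP => ->; rewrite mulg_sbarK.
rewrite -big_mkcondr; have [up_pred|not_up] := boolP (up rho (sigma' * sbar i)%g i).
  rewrite (big_pred1 (sigma' * sbar i)%g) // => s; rewrite predE /=.
  case: eqP => [->|]; rewrite ?andbF // up_pred !andbT.
  apply: Omega_sbar => //; move: up_pred; rewrite up_sbar.
  by rewrite neq_ltn => ->; rewrite orbT.
rewrite big_pred0 // => s; rewrite predE.
by case: eqP => [->|]; rewrite ?andbF // (negPf not_up) andbF.
Qed.

Lemma stone_exchange_law_stationary mu' sigma' : mu' \in S -> sigma' \in Omega rho ->
  \sum_(sigma in Omega rho) \sum_(mu <- S)
    L mu sigma * trans rho a p mu sigma mu' sigma' = L mu' sigma'.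
Proof.
move=> muS sigmaO.
under eq_bigr => sigma sigmaO' do rewrite sum_words_trans // [X in _ + X]big_mkcond.
rewrite big_split /= exchange_big /=.
rewrite -big_mkcondr (big_pred1 sigma') => [|s]; last first.
  by rewrite /= eq_sym; case: eqP => [->|]; rewrite ?sigmaO ?andbF.
under [X in _ + X]eq_bigr => i _.
  under eq_bigr do rewrite -if_and.
  rewrite sum_Omega_predecessor //; over.
rewrite -big_mkcond sumr_const -(card_up_sbar rho12) cardsE.
have n0 : n%:R != 0 :> R by rewrite pnatr_eq0; lia.
by rewrite -mulr_natl; field.
Qed.

Lemma stone_exchange_law_distribution :
  (forall mu sigma, mu \in S -> 0 <= L mu sigma) ->
  (forall sigma, \sum_(mu <- S) L mu sigma = 1) ->
  is_stationary_distribution rho a p lam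
    (fun mu sigma => (#|Omega rho|%:R)^-1 * L mu sigma).
Proof.
move=> L0 L1; split=> [mu sigma muS _||mu' sigma' muS sigmaO].
- by rewrite mulr_ge0 ?invr_ge0 ?ler0n ?L0.
- rewrite exchange_big /=; under eq_bigr do rewrite -mulr_sumr L1 mulr1.
  rewrite sumr_const -(mulr_natl _^-1) mulfV // pnatr_eq0 -lt0n.
  by apply/card_gt0P; exists 1%g; apply: Omega1.
- rewrite -[in LHS](stone_exchange_law_stationary muS sigmaO) exchange_big /=.
  rewrite mulr_sumr; apply: eq_bigr => sigma _; rewrite mulr_sumr.
  by apply: eq_bigr => mu _; rewrite mulrA.
Qed.

End StonedChain.

(** * Limits of rational functions at infinity *)

Section RationalLimits.
Variable R : realType.
Implicit Types f g : {poly R}.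

Lemma cvg_horner_div_expr g d : (size g <= d.+1)%N ->
  g.[r] / r ^+ d @[r --> +oo] --> g`_d.
Proof.
move=> sg; pose g' := \poly_(i < d.+1) g`_(d - i).
have -> : g`_d = g'.[0] by rewrite horner_coef0 coef_poly /= subn0.
apply: (@cvg_trans _ (g'.[r^-1] @[r --> +oo])); last first.
  apply: (cvg_comp (fun r : R => r^-1) (horner g')); last exact: continuous_horner.
  by apply/(gtr0_cvgV0 (f := id)) => //; exact: nbhs_pinfty_gt.
apply: near_eq_cvg; near=> r.
have r0 : r != 0 by apply: lt0r_neq0; near: r; exact: nbhs_pinfty_gt.
rewrite (horner_coef_wide r sg) horner_poly mulr_suml.
rewrite (reindex_inj rev_ord_inj) /=; apply: eq_bigr => i _.
have le_id : (i <= d)%N by rewrite -ltnS.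
have -> : r ^+ d = r ^+ (d - i) * r ^+ i by rewrite -exprD subnK.
by rewrite subSS exprVn invfM mulrA subKn // [RHS]mulrAC mulfK // expf_neq0.
Unshelve. all: by end_near.
Qed.

Lemma cvg_horner_ratio f g : g != 0 -> (size f <= size g)%N ->
  f.[r] / g.[r] @[r --> +oo] --> f`_(size g).-1 / lead_coef g.
Proof.
move=> g0 sfg; set d := (size g).-1.
have sg : size g = d.+1 by rewrite prednK // size_poly_gt0.
apply: (@cvg_trans _ (f.[r] / r ^+ d / (g.[r] / r ^+ d) @[r --> +oo])).
  apply: near_eq_cvg; near=> r.
  have r0 : r != 0 by apply: lt0r_neq0; near: r; exact: nbhs_pinfty_gt.
  by rewrite invf_div mulrA mulfVK // expf_neq0.
apply: cvgM; first by apply: cvg_horner_div_expr; rewrite -sg.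
apply: cvgV; first by rewrite lead_coef_eq0.
by rewrite lead_coefE -/d; apply: cvg_horner_div_expr; rewrite sg.
Unshelve. all: by end_near.
Qed.

Lemma size_poly_le_near f g (C : R) :
  (\forall r \near +oo, `|f.[r]| <= C * `|g.[r]|) -> (size f <= size g)%N.
Proof.
move=> fg; rewrite leqNgt; apply/negP => sgf.
set e := (size f).-1; have sf : size f = e.+1 by rewrite prednK // (leq_trans _ sgf).
have f_lim : `|f.[r] / r ^+ e| @[r --> +oo] --> `|f`_e|.
  by apply: cvg_norm; apply: cvg_horner_div_expr; rewrite sf.
have g_lim : C * `|g.[r] / r ^+ e| @[r --> +oo] --> C * `|g`_e|.
  apply: cvgM; first exact: cvg_cst.
  by apply: cvg_norm; apply: cvg_horner_div_expr; rewrite -sf ltnW.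
have : `|f`_e| <= C * `|g`_e|.
  apply: ler_cvg_to f_lim g_lim _; near=> r.
  by rewrite !normrM mulrA ler_wpM2r //; near: r.
have -> : g`_e = 0 by rewrite nth_default // -ltnS -sf.
rewrite normr0 mulr0 normr_le0 -lead_coefE lead_coef_eq0.
by apply/negP; rewrite -size_poly_gt0 sf.
Unshelve. all: by end_near.
Qed.

Lemma ev_horner n (x : 'I_n -> {poly R}) (f : mpoly.mpoly n R) :
  exists g : {poly R}, forall r, ev (fun j => (x j).[r]) f = g.[r].
Proof.
exists (\sum_(m <- mpoly.msupp f)
  mpoly.mcoeff m f *: \prod_i x i ^+ mpoly.fun_of_multinom m i) => r.
rewrite /ev mpoly.mevalE horner_sum; apply: eq_bigr => m _.
rewrite hornerZ horner_prod; congr (_ * _).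
by apply: eq_bigr => i _; rewrite horner_exp.
Qed.

End RationalLimits.

(** * The limiting weights *)

Section StoneLimit.
Variables (R : realType) (n : nat) (a : nat -> R) (lam : seq nat).
Variables (rho : 'I_n -> nat) (p : 'I_n -> R) (Psi : seq nat -> mpoly.mpoly n R).
Variables (light heavy : 'I_n).
Hypothesis a01 : forall k, 0 < a k < 1.
Hypothesis size_lam : size lam = n.
Hypothesis lam_sorted : sorted leq lam.
Hypothesis rho12 : forall j, (rho j == 1)%N || (rho j == 2)%N.
Hypothesis p01 : forall j, rho j = 1%N -> 0 <= p j < 1.
Hypothesis rho_light : rho light = 1%N.
Hypothesis p_light : 0 < p light.
Hypothesis rho_heavy : rho heavy = 2%N.
Hypothesis Psi_iTASEP : is_iTASEP_family a lam Psi.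
Hypothesis Pi_neq0 : \forall r \near +oo, Pi_ev lam Psi (chi rho p r) != 0.
Local Notation S := (permutations lam).
Implicit Types (mu : seq nat) (sigma : 'S_n) (i : 'I_n).

Let Psi_exchange : exchange_law a lam (fun x mu => ev x (Psi mu)) :=
  iTASEP_exchange_law a01 size_lam Psi_iTASEP.

Definition stone_ratio mu sigma (r : R) : R :=
  ev (act_tuple sigma (chi rho p r)) (Psi mu) / Pi_ev lam Psi (chi rho p r).

Definition stone_limit mu sigma : R := lim (stone_ratio mu sigma r @[r --> +oo]).

Lemma near_chi_ge1 : \forall r \near +oo, forall j, 1 <= chi rho p r j.
Proof.
near=> r => j; rewrite /chi; case: ifP => [/andP[/eqP rho1 pj0]|_].
  by have /andP[_ /ltW pj1] := p01 rho1; rewrite invf_ge1.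
by near: r; apply: nbhs_pinfty_ge.
Unshelve. all: by end_near.
Qed.

Lemma near_chi_lt : \forall r \near +oo, chi rho p r light < chi rho p r heavy.
Proof.
rewrite /chi rho_light rho_heavy p_light /=.
by apply: nbhs_pinfty_gt; rewrite num_real.
Qed.

Lemma Pi_ev_act_tuple sigma (x : 'I_n -> R) : (forall j, 1 <= x j) ->
  Pi_ev lam Psi (act_tuple sigma x) = Pi_ev lam Psi x.
Proof. by move=> x1; apply: (exchange_law_sum size_lam Psi_exchange x1). Qed.

Lemma near_stone_ratio_bounds mu sigma : mu \in S ->
  \forall r \near +oo, 0 <= stone_ratio mu sigma r <= 1.
Proof.
move=> muS; near=> r.
have chi1 : forall j, 1 <= chi rho p r j by near: r; exact: near_chi_ge1.
rewrite /stone_ratio -(Pi_ev_act_tuple sigma chi1).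
apply: (exchange_law_share_bounds a01 size_lam (j := sigma light)
  (m := sigma heavy) Psi_exchange) => // [l|]; first exact: chi1.
by rewrite /act_tuple !permK; near: r; exact: near_chi_lt.
Unshelve. all: by end_near.
Qed.

Lemma ev_act_chi_horner mu sigma : exists f : {poly R},
  forall r, ev (act_tuple sigma (chi rho p r)) (Psi mu) = f.[r].
Proof.
pose c j : {poly R} := if (rho j == 1%N) && (0 < p j) then ((p j)^-1)%:P else 'X.
have [f fE] := ev_horner (fun j => c (sigma^-1%g j)) (Psi mu).
exists f => r; rewrite -fE; congr ev; apply/funext => j.
by rewrite /act_tuple /chi /c; case: ifP => _; rewrite ?hornerC ?hornerX.
Qed.

Lemma Pi_ev_chi_horner : exists g : {poly R},
  forall r, Pi_ev lam Psi (chi rho p r) = g.[r].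
Proof.
have /choice[g gE] nu := ev_act_chi_horner nu 1%g.
exists (\sum_(nu <- S) g nu) => r; rewrite horner_sum.
by apply: eq_bigr => nu _; rewrite -gE act_tuple1.
Qed.

Lemma cvg_stone_ratio mu sigma : mu \in S ->
  stone_ratio mu sigma r @[r --> +oo] --> stone_limit mu sigma.
Proof.
move=> muS; have [f fE] := ev_act_chi_horner mu sigma.
have [g gE] := Pi_ev_chi_horner.
have g0 : g != 0.
  have [r] := filter_ex Pi_neq0; rewrite gE.
  by apply: contraNneq => ->; rewrite horner0.
have ratioE : stone_ratio mu sigma = fun r => f.[r] / g.[r].
  by apply/funext => r; rewrite /stone_ratio fE gE.
rewrite /stone_limit ratioE; apply/cvg_ex; eexists.
apply: cvg_horner_ratio => //; apply: (size_poly_le_near (C := 1)); near=> r.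
have gr0 : 0 < `|g.[r]| by rewrite normr_gt0 -gE; near: r.
rewrite -ler_pdivrMr // -normf_div.
have : 0 <= stone_ratio mu sigma r <= 1 by near: r; exact: near_stone_ratio_bounds.
by rewrite ratioE => /andP[? ?]; rewrite ger0_norm.
Unshelve. all: by end_near.
Qed.

Lemma stone_limit_ge0 mu sigma : mu \in S -> 0 <= stone_limit mu sigma.
Proof.
move=> muS; apply: (@cvgr_to_ge _ _ _ _ _ _ _ (cvg_stone_ratio (sigma := sigma) muS)).
by apply: filterS (near_stone_ratio_bounds sigma muS) => r /andP[].
Qed.

Lemma sum_stone_limit sigma : \sum_(mu <- S) stone_limit mu sigma = 1.
Proof.
have sum_cvg : \sum_(mu <- S) stone_ratio mu sigma r @[r --> +oo] -->
    \sum_(mu <- S) stone_limit mu sigma.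
  rewrite [X in _ --> X]big_seq; under eq_fun do rewrite big_seq.
  by apply: cvg_big => [|mu muS]; [exact: add_continuous|exact: cvg_stone_ratio].
apply: (norm_cvg_unique sum_cvg); apply: cvg_near_cst; near=> r.
have Pi0 : Pi_ev lam Psi (chi rho p r) != 0 by near: r.
rewrite -mulr_suml -/(Pi_ev lam Psi _) Pi_ev_act_tuple ?divff //.
by near: r; exact: near_chi_ge1.
Unshelve. all: by end_near.
Qed.

Lemma cvg_exchange_prob sigma i k : up rho sigma i ->
  exchange_prob a i (act_tuple sigma (chi rho p r)) k @[r --> +oo] -->
  stone_prob a p sigma i k.
Proof.
move=> /(up_densities rho12)[rho_i rho_iS].
rewrite /exchange_prob /act_tuple /stone_prob; set j := sigma^-1%g i in rho_i *.
rewrite {1}/chi rho_iS /=; under eq_fun do rewrite /chi rho_i rho_iS /=.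
have /andP[] := p01 rho_i; rewrite le_eqVlt => /predU1P[<- _|pj0 _].
  by rewrite ltxx mul0r; under eq_fun do rewrite subrr mulr0 mul0r; apply: cvg_cst.
rewrite pj0; have ratio1 : ('X - (p j)^-1%:P).[r] / ('X - (a k)%:P).[r]
    @[r --> +oo] --> (1 : R).
  have := @cvg_horner_ratio R ('X - (p j)^-1%:P) ('X - (a k)%:P).
  rewrite !size_XsubC polyXsubC_eq0 lead_coefXsubC coefB coefX coefC subr0 divr1.
  exact.
have : p j * a k * (('X - (p j)^-1%:P).[r] / ('X - (a k)%:P).[r]) @[r --> +oo] -->
    p j * a k * 1 by apply: cvgM => //; exact: cvg_cst.
rewrite mulr1; apply: cvg_trans; apply: near_eq_cvg; apply: nearW => r /=.
by rewrite !hornerXsubC invfM invrK; ring.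
Qed.

Lemma stone_limit_exchange_law : stone_exchange_law a lam rho p stone_limit.
Proof.
move=> mu sigma i muS _ up_i; apply: cvg_lim => //.
have muS' := mem_act_word size_lam (sbar i) muS.
pose x r := act_tuple sigma (chi rho p r).
apply: (@cvg_trans _ (sort_step i (exchange_prob a i (x r))
  (fun nu => stone_ratio nu sigma r) mu @[r --> +oo])).
  apply: near_eq_cvg; near=> r.
  have chi1 : forall j, 1 <= chi rho p r j by near: r; exact: near_chi_ge1.
  rewrite /stone_ratio -act_tupleM Psi_exchange // => [|j]; last exact: chi1.
  by rewrite /sort_step -/(x r); ring.
have cvg_prob nu : sort_prob i (exchange_prob a i (x r)) nu @[r --> +oo] -->
    sort_prob i (stone_prob a p sigma i) nu.
  by rewrite /sort_prob; case: ifP => _; [exact: cvg_exchange_prob|exact: cvg_cst].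
apply: cvgD; apply: cvgM => //; try exact: cvg_stone_ratio.
by apply: cvgB => //; exact: cvg_cst.
Unshelve. all: by end_near.
Qed.

Lemma stone_limit_stationary_distribution : (1 < n)%N ->
  is_stationary_distribution rho a p lam
    (fun mu sigma => (#|Omega rho|%:R)^-1 * stone_limit mu sigma).
Proof.
move=> n_gt1; apply: (stone_exchange_law_distribution n_gt1 size_lam rho12).
- exact: stone_limit_exchange_law.
- by move=> mu sigma; apply: stone_limit_ge0.
- exact: sum_stone_limit.
Qed.

End StoneLimit.

Theorem theorem6p1 (R : realType) (n : nat) (a : nat -> R) (lam : seq nat)
    (rho : 'I_n -> nat) (p : 'I_n -> R) (Psi : seq nat -> mpoly.mpoly n R) :
  (1 < n)%N ->
  (forall k, 0 < a k < 1) ->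
  size lam = n -> sorted leq lam ->
  (forall i j : 'I_n, (i <= j)%N -> (rho i <= rho j)%N) ->
  (forall j, (rho j == 1)%N || (rho j == 2)%N) ->
  (forall j : 'I_n, nat_of_ord j = 0%N -> rho j = 1%N) ->
  (forall j : 'I_n, nat_of_ord j = n.-1 -> rho j = 2%N) ->
  (forall j, rho j = 1%N -> 0 <= p j < 1) ->
  (exists j, rho j = 1%N /\ 0 < p j) ->
  is_iTASEP_family a lam Psi ->
  (\forall r \near +oo, Pi_ev lam Psi (chi rho p r) != 0) ->
  exists L : seq nat -> 'S_n -> R,
    (forall mu sigma, mu \in permutations lam -> sigma \in Omega rho ->
       ev (act_tuple sigma (chi rho p r)) (Psi mu)
         / Pi_ev lam Psi (chi rho p r) @[r --> +oo] --> L mu sigma)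
    /\ is_stationary_distribution rho a p lam
         (fun mu sigma => (#|Omega rho|%:R)^-1 * L mu sigma).
Proof.
move=> n_gt1 a01 size_lam lam_sorted _ rho12 _ rho_last p01 [light [rho_light p_light]].
move=> Psi_iTASEP Pi_neq0.
have last_lt : (n.-1 < n)%N by rewrite ltn_predL ltnW.
have rho_heavy := rho_last (Ordinal last_lt) erefl.
exists (stone_limit lam rho p Psi); split=> [mu sigma muS _|].
- exact: (cvg_stone_ratio a01 size_lam lam_sorted p01 rho_light p_light rho_heavy
    Psi_iTASEP Pi_neq0).
- exact: (stone_limit_stationary_distribution a01 size_lam lam_sorted rho12 p01
    rho_light p_light rho_heavy Psi_iTASEP Pi_neq0 n_gt1).
Qed.
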